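(* Let $d\ge0$, $I_1,I_2,I_3>0$ pairwise distinct, $a_k=(I_k+d)^{-1}$, $\mathbf A=\mathrm{diag}(a_1,a_2,a_3)$, $\mathbf E$ the unit $3\times3$ matrix, $\mathrm g=\bigl(1-d(\gamma,\mathbf A\gamma)\bigr)^{-1/2}$, and $$\mathbf B_\gamma=\mathrm{diag}\bigl((a_1-a_3)(a_1-a_2)\gamma_1^2,\ (a_2-a_3)(a_2-a_1)\gamma_2^2,\ (a_3-a_1)(a_3-a_2)\gamma_3^2\bigr).$$ On the level set $(\gamma,\gamma)=1$, $(\gamma,M)=0$ the functions $$\tilde H=(\tilde{\mathbf A}'_\gamma M,M),\qquad \tilde{\mathbf A}'_\gamma=\frac{\mathbf A-(\gamma,\mathbf A\gamma)\mathbf E}{2}+d\,\mathrm g^2\,\mathbf B_\gamma,$$ $$\tilde K=4\,\mathrm g^2\,(\gamma,\mathbf AM)^2\,\Bigl((\mathbf E-d\mathbf A-d^2\mathrm g^2\mathbf B_\gamma)M,M\Bigr)$$ are in involution with respect to the Poisson bracket $$\{M_i,M_j\}=\varepsilon_{ijk}\bigl(\mathrm g^{-1}M_k-d\,\mathrm g\,(M,\mathbf A\gamma)\gamma_k\bigr),\quad \{M_i,\gamma_j\}=\varepsilon_{ijk}\mathrm g^{-1}\gamma_k,\quad \{\gamma_i,\gamma_j\}=0,$$ and also with respect to the second Poisson bracket $\{\cdot,\cdot\}'$ defined in the local coordinates $(\tilde u_1,\tilde u_2,\tilde p_{u_1},\tilde p_{u_2})$ (see context) on this level set by $$\{\tilde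 u_i,\tilde p_{u_j}\}'=\lambda_i\delta_{ij},\quad \{\tilde u_1,\tilde u_2\}'=\{\tilde p_{u_1},\tilde p_{u_2}\}'=0,\qquad \lambda_k=4(d\tilde u_k-1)(a_1-\tilde u_k)(a_2-\tilde u_k)(a_3-\tilde u_k)\tilde p_{u_k}^2 .$$
   Context: $(\cdot,\cdot)$ is the Euclidean scalar product on $\mathbb R^3$, $\varepsilon_{ijk}$ the totally skew-symmetric tensor (summation over $k$); $(\gamma,\gamma)$ and $(\gamma,M)$ are Casimir functions of the first bracket, so it restricts to the 4-dimensional level set $(\gamma,\gamma)=1$, $(\gamma,M)=0$. Coordinates $(u,p_u)$: on this level set (locally, generically) $(u_1,u_2,p_{u_1},p_{u_2})$ are defined by $$\gamma_i=\sqrt{\frac{(1-da_j)(1-da_k)}{(1-du_1)(1-du_2)}}\sqrt{\frac{(u_1-a_i)(u_2-a_i)}{(a_j-a_i)(a_k-a_i)}}$$ (equivalently $u_1,u_2$ are the roots $\lambda$ of $\sum_i\gamma_i^2(1-da_i)/(\lambda-a_i)=0$) and $$M_i=\frac{2\varepsilon_{ijk}\gamma_j\gamma_k(a_j-a_k)\mathrm g}{u_1-u_2}\Bigl((a_i-u_1)(1-du_1)p_{u_1}-(a_i-u_2)(1-du_2)p_{u_2}\Bigr),$$ with $(i,j,k)$ a cyclic permutation of $(1,2,3)$ (no summation). Coordinates $(\tilde u,\tilde p_u)$: these are the values of the functions $u_1,u_2,p_{u_1},p_{u_2}$ at the point $(\tilde\gamma,\tilde M)$, where $$\tilde\gamma_i^2=\frac{1}{(a_id-1)\tilde{\mathrm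 g}^2}\left(\gamma_i^2-\frac{(\gamma,\gamma)(M_j^2+M_k^2)}{(M,M)}\right),\quad \{i,j,k\}=\{1,2,3\},$$ $$\tilde M_i=\frac{\mathrm g}{\tilde{\mathrm g}}\left(-\frac{(\tilde\gamma_j^2+\tilde\gamma_k^2)\gamma_j\gamma_kM_i}{\tilde\gamma_j\tilde\gamma_k}+\frac{\gamma_i\tilde\gamma_j\gamma_kM_j}{\tilde\gamma_k}+\frac{\gamma_i\gamma_j\tilde\gamma_kM_k}{\tilde\gamma_j}\right),\quad \{i,j,k\}=\{1,2,3\},$$ $$\tilde{\mathrm g}^2=\bigl(1-d(\tilde\gamma,\mathbf A\tilde\gamma)\bigr)^{-1}=\frac{1}{\mathrm g^2}\cdot\frac{dH_1-H_2}{(a_1d-1)(a_2d-1)(a_3d-1)H_2},$$ with $H_1=(M,\mathbf AM)+d\,\mathrm g^2(\gamma,\mathbf AM)^2$, $H_2=(M,M)$. Signs of square roots and labelling of roots are chosen smoothly on an open set where $M\ne0$, all $\tilde\gamma_i\neq0$, $u_1\neq u_2$, $\tilde u_1\ne\tilde u_2$, and all denominators are nonzero. *)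

(* Defs.v *)
From HB Require Import structures.
From mathcomp Require Import all_boot all_order all_algebra.
From mathcomp Require Import all_classical all_reals all_analysis.
Set Implicit Arguments.
Unset Strict Implicit.
Unset Printing Implicit Defensive.
Import Order.TTheory GRing.Theory Num.Theory.
Import numFieldNormedType.Exports.
Local Open Scope classical_set_scope.
Local Open Scope ring_scope.

(* Indices 1, 2, 3 are the elements 0, 1, 2 of 'I_3; addition on 'I_3 is modulo
   3, so (i, i + 1, i + 2) runs over the cyclic permutations of (1, 2, 3).
   A trailing t in a name stands for a tilde. *)

Section ChaplyginBall.
Variable R : realType.

(* A point (gamma, M), respectively (u, p_u). *)
Local Notation phase := ('cV[R]_3 * 'cV[R]_3)%type.
Local Notation coord := ('cV[R]_2 * 'cV[R]_2)%type.

Definition dot (x y : 'cV[R]_3) : R := \sum_i x i 0 * y i 0.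

Definition levi (i j k : 'I_3) : R :=
  if (j == i + 1) && (k == i + 2) then 1
  else if (j == i + 2) && (k == i + 1) then -1 else 0.

Definition level : set phase := [set z | dot z.1 z.1 = 1 /\ dot z.1 z.2 = 0].

Section System.
Variables (d : R) (I : 'I_3 -> R).

Definition a (i : 'I_3) : R := (I i + d)^-1.

Definition Amx : 'M[R]_3 := diag_mx (\row_i a i).

Definition g (gam : 'cV[R]_3) : R :=
  (Num.sqrt (1 - d * dot gam (Amx *m gam)))^-1.

Definition Bmx (gam : 'cV[R]_3) : 'M[R]_3 :=
  diag_mx (\row_i ((a i - a (i + 1)) * (a i - a (i + 2)) * gam i 0 ^+ 2)).

Definition Amx' (gam : 'cV[R]_3) : 'M[R]_3 :=
  2^-1 *: (Amx - (dot gam (Amx *m gam))%:M) + (d * g gam ^+ 2) *: Bmx gam.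

Definition Ht (z : phase) : R :=
  let: (gam, M) := z in dot (Amx' gam *m M) M.

Definition Kt (z : phase) : R :=
  let: (gam, M) := z in
  4 * g gam ^+ 2 * dot gam (Amx *m M) ^+ 2
    * dot ((1%:M - d *: Amx - (d ^+ 2 * g gam ^+ 2) *: Bmx gam) *m M) M.

Definition dgam (i : 'I_3) (f : phase -> R) z : R :=
  'D_(delta_mx i 0, 0) f z.
Definition dM (i : 'I_3) (f : phase -> R) z : R :=
  'D_(0, delta_mx i 0) f z.

Definition brMM (i j : 'I_3) (z : phase) : R :=
  let: (gam, M) := z in
  \sum_k levi i j k *
    ((g gam)^-1 * M k 0 - d * g gam * dot M (Amx *m gam) * gam k 0).

Definition brMgam (i j : 'I_3) (z : phase) : R :=
  let: (gam, M) := z in \sum_k levi i j k * ((g gam)^-1 * gam k 0).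

(* The biderivation with {M_i, M_j} = brMM i j, {M_i, gamma_j} = brMgam i j and
   {gamma_i, gamma_j} = 0. As (gamma, gamma) and (gamma, M) are Casimir
   functions, its value at a point of [level] only depends on the restrictions
   of f and h to [level]. *)
Definition bracket (f h : phase -> R) z : R :=
  \sum_i \sum_j (dM i f z * dM j h z * brMM i j z
    + (dM i f z * dgam j h z - dgam j f z * dM i h z) * brMgam i j z).

(* The square of the defining relation gamma_i = sqrt(_) * sqrt(_), which
   leaves the sign of each gamma_i free. *)
Definition u_rel (gam : 'cV[R]_3) (u : 'cV[R]_2) : Prop :=
  let u1 := u 0 0 in let u2 := u 1 0 in
  [/\ u1 != u2, 1 - d * u1 != 0, 1 - d * u2 != 0 &
    forall i : 'I_3, let j := i + 1 in let k := i + 2 in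
      gam i 0 ^+ 2 =
        (1 - d * a j) * (1 - d * a k) / ((1 - d * u1) * (1 - d * u2))
        * ((u1 - a i) * (u2 - a i) / ((a j - a i) * (a k - a i)))].

Definition p_rel (gam M : 'cV[R]_3) (u p : 'cV[R]_2) : Prop :=
  let u1 := u 0 0 in let u2 := u 1 0 in
  let p1 := p 0 0 in let p2 := p 1 0 in
  forall i : 'I_3, let j := i + 1 in let k := i + 2 in
    M i 0 = 2 * gam j 0 * gam k 0 * (a j - a k) * g gam / (u1 - u2)
      * ((a i - u1) * (1 - d * u1) * p1 - (a i - u2) * (1 - d * u2) * p2).

Definition H1 (gam M : 'cV[R]_3) : R :=
  dot M (Amx *m M) + d * g gam ^+ 2 * dot gam (Amx *m M) ^+ 2.

Definition H2 (M : 'cV[R]_3) : R := dot M M.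

(* Here g~ = g gamt; the last relation is the second expression of g~^2. The
   signs of the gamma~_i are left free. *)
Definition gamt_rel (gam M gamt : 'cV[R]_3) : Prop :=
  [/\ forall i : 'I_3, gamt i 0 != 0,
    forall i : 'I_3, let j := i + 1 in let k := i + 2 in
      gamt i 0 ^+ 2 = ((a i * d - 1) * g gamt ^+ 2)^-1 *
        (gam i 0 ^+ 2 - dot gam gam * (M j 0 ^+ 2 + M k 0 ^+ 2) / dot M M) &
    g gamt ^+ 2 = (g gam ^+ 2)^-1 * ((d * H1 gam M - H2 M) /
      ((a 0 * d - 1) * (a 1 * d - 1) * (a 2 * d - 1) * H2 M))].

Definition Mt (gam M gamt : 'cV[R]_3) : 'cV[R]_3 :=
  \col_i (let j := i + 1 in let k := i + 2 in
    g gam / g gamt *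
    (- ((gamt j 0 ^+ 2 + gamt k 0 ^+ 2) * gam j 0 * gam k 0 * M i 0
          / (gamt j 0 * gamt k 0))
     + gam i 0 * gamt j 0 * gam k 0 * M j 0 / gamt k 0
     + gam i 0 * gam j 0 * gamt k 0 * M k 0 / gamt j 0)).

End System.

(* f is of class C^n on the open set U. *)
Fixpoint Cn (V W : normedModType R) (n : nat) (U : set V) (f : V -> W) : Prop :=
  if n is n'.+1 then
    (forall x, U x -> differentiable f x) /\
    (forall v, Cn n' U (fun x => 'D_v f x))
  else forall x, U x -> {for x, continuous f}.

Definition smooth (V W : normedModType R) (U : set V) (f : V -> W) : Prop :=
  forall n, Cn n U f.

(* phi is a system of local coordinates on the open subset W of the submanifold
   S: it is a homeomorphism from W onto the open set phi @` W, whose inverse psi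
   is a smooth immersion. *)
Definition local_coordinates (S W : set phase)
    (phi : phase -> coord) (psi : coord -> phase) : Prop :=
  (exists2 O, open O & W = O `&` S) /\
  [/\ open (phi @` W),
      forall z, W z -> psi (phi z) = z,
      {within W, continuous phi},
      smooth (phi @` W) psi &
      forall x, (phi @` W) x -> forall v, 'D_v psi x = 0 -> v = 0].

(* phi = (u~, p~_u) on W, for the choice gamt of the signs of the gamma~_i. The
   condition on [u] says that u_1 and u_2 differ at (gamma, M). *)
Definition tilde_coordinates (d : R) (I : 'I_3 -> R)
    (W : set phase) (phi : phase -> coord) (psi : coord -> phase)
    (gamt : phase -> 'cV[R]_3) : Prop :=
  [/\ local_coordinates level W phi psi,
      smooth (phi @` W) (gamt \o psi) &
      forall gam M, W (gam, M) ->
        let gt := gamt (gam, M) in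
        let: (ut, pt) := phi (gam, M) in
        [/\ M != 0, (exists u, u_rel d I gam u), gamt_rel d I gam M gt,
            u_rel d I gt ut & p_rel d I gt (Mt d I gam M gt) ut pt]].

Definition lambda (d : R) (I : 'I_3 -> R) (k : 'I_2) (x : coord) : R :=
  let u := x.1 k 0 in let p := x.2 k 0 in
  4 * (d * u - 1) * (a d I 0 - u) * (a d I 1 - u) * (a d I 2 - u) * p ^+ 2.

Definition du (k : 'I_2) (F : coord -> R) x : R :=
  'D_(delta_mx k 0, 0) F x.
Definition dp (k : 'I_2) (F : coord -> R) x : R :=
  'D_(0, delta_mx k 0) F x.

(* {f, h}' on the domain of the coordinates phi with inverse psi: the
   biderivation with {u_i, p_j}' = lambda_i delta_ij, {u_1, u_2}' = 0 and
   {p_1, p_2}' = 0. *)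
Definition bracket' (d : R) (I : 'I_3 -> R)
    (phi : phase -> coord) (psi : coord -> phase)
    (f h : phase -> R) (z : phase) : R :=
  let x := phi z in
  \sum_k lambda d I k x * (du k (f \o psi) x * dp k (h \o psi) x
                           - dp k (f \o psi) x * du k (h \o psi) x).

End ChaplyginBall.

(* Main.v *)
Require Import Defs.
From HB Require Import structures.
From mathcomp Require Import all_boot all_order all_algebra.
From mathcomp Require Import all_classical all_reals all_analysis.
From mathcomp Require Import ring lra.
Import Order.TTheory GRing.Theory Num.Theory.
Import numFieldNormedType.Exports.
Local Open Scope classical_set_scope.
Local Open Scope ring_scope.
Set Implicit Arguments.
Unset Strict Implicit.
Unset Printing Implicit Defensive.

(** Put N = (M, M), J = (M, A M), alpha = (gamma, A gamma), tau = (gamma, A M),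
    L = gamma x M. On the level set (B_gamma M, M) = tau^2, so that
    H~ = (J - alpha N) / 2 + d g^2 tau^2 and
    K~ = 4 g^2 tau^2 (N - d J - d^2 g^2 tau^2).

    First bracket: up to multiples of the gradient of the Casimir function
    (gamma, M), the gradients of H~ and K~ are combinations of those of N, J,
    alpha and tau, whose mutual brackets are expressed by triple products; these
    are reduced to (L, A gamma) and (L, A M) in the frame gamma, M, L.

    Second bracket: gamma~_i^2 is proportional to L_i^2 / (1 - d a_i), so the
    u~_k are the roots of sum_i L_i^2 / (u - a_i), and p~_k turns out to be
    (g / 2) sum_i gamma_i L_i / (a_i - u~_k). As (L, (A - u~_k)^-1 L) = 0, the
    Cauchy-Binet formula gives lambda_k = g^2 (1 - d u~_k) (J - u~_k N), whence
    H~ = (lambda_1 + lambda_2) / 2 and K~ = - 4 lambda_1 lambda_2. Functions of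
    lambda_1 and lambda_2 commute, since lambda_k only depends on
    (u~_k, p~_k). *)

(** * Sums over the three cyclic indices, and tactics preparing polynomial identities *)

Lemma big_I3 (V : nmodType) (F : 'I_3 -> V) : \sum_i F i = F 0 + F 1 + F 2.
Proof.
rewrite !big_ord_recl big_ord0 addr0 addrA.
by congr (F _ + F _ + F _); apply: val_inj.
Qed.

Lemma I3_add :
  ((0 + 1 = 1 :> 'I_3)%R * (0 + 2 = 2 :> 'I_3)%R * (1 + 1 = 2 :> 'I_3)%R
   * (1 + 2 = 0 :> 'I_3)%R * (2 + 1 = 0 :> 'I_3)%R
   * (2 + 2 = 1 :> 'I_3)%R)%type.
Proof. by do !split; apply: val_inj. Qed.

(** Replacing matrix entries by plain variables turns a vector identity into a polynomial one with
    atoms that [ring] recognizes. *)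
Ltac entries :=
  repeat match goal with
  | |- context [fun_of_matrix ?x ?i ?j] =>
      generalize (fun_of_matrix x i j); intro
  end.

Ltac dots :=
  repeat match goal with
  | |- context [g ?d ?I ?x] => generalize (g d I x); intro
  end;
  repeat match goal with
  | |- context [dot ?x ?y] => generalize (dot x y); intro
  end.

(** * Scalar and vector products in three dimensions *)

Section Vectors.
Variable R : realType.
Implicit Types (x y z M gam : 'cV[R]_3) (d : R) (I : 'I_3 -> R).

Definition cross x y : 'cV[R]_3 :=
  \col_i (x (i + 1) 0 * y (i + 2) 0 - x (i + 2) 0 * y (i + 1) 0).

Lemma dotE x y : dot x y = x 0 0 * y 0 0 + x 1 0 * y 1 0 + x 2 0 * y 2 0.
Proof. exact: big_I3. Qed.

Lemma diag_mulE (c : 'I_3 -> R) x i :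
  (diag_mx (\row_j c j) *m x) i 0 = c i * x i 0.
Proof. by rewrite mul_diag_mx !mxE. Qed.

Lemma dot_crossE x y z : dot (cross x y) z =
  (x 1 0 * y 2 0 - x 2 0 * y 1 0) * z 0 0 +
  (x 2 0 * y 0 0 - x 0 0 * y 2 0) * z 1 0 +
  (x 0 0 * y 1 0 - x 1 0 * y 0 0) * z 2 0.
Proof. by rewrite dotE !mxE !I3_add. Qed.

Lemma dotC x y : dot x y = dot y x.
Proof. by rewrite !dotE; ring. Qed.

Lemma dotDl x y z : dot (x + y) z = dot x z + dot y z.
Proof. by rewrite !dotE !mxE; ring. Qed.

Lemma dotZl (c : R) x z : dot (c *: x) z = c * dot x z.
Proof. by rewrite !dotE !mxE; ring. Qed.

Lemma dotBl x y z : dot (x - y) z = dot x z - dot y z.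
Proof. by rewrite !dotE !mxE; ring. Qed.

Lemma dot0l x : dot 0 x = 0.
Proof. by rewrite -(scale0r 0) dotZl mul0r. Qed.

Lemma dot_delta x i : dot x (delta_mx i 0) = x i 0.
Proof.
rewrite /dot (bigD1 i) //= !mxE !eqxx mulr1 big1 ?addr0 // => j ji.
by rewrite !mxE (negbTE ji) mulr0.
Qed.

Lemma crossDl x y z : cross (x + y) z = cross x z + cross y z.
Proof. by apply/colP => i; rewrite !mxE; ring. Qed.

Lemma crossDr x y z : cross z (x + y) = cross z x + cross z y.
Proof. by apply/colP => i; rewrite !mxE; ring. Qed.

Lemma crossZl (c : R) x z : cross (c *: x) z = c *: cross x z.
Proof. by apply/colP => i; rewrite !mxE; ring. Qed.

Lemma crossZr (c : R) x y : cross x (c *: y) = c *: cross x y.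
Proof. by apply/colP => i; rewrite !mxE; ring. Qed.

Lemma crossC x y : cross x y = - cross y x.
Proof. by apply/colP => i; rewrite !mxE; ring. Qed.

(** The triple products are determinants, so their product is the determinant of the Gram matrix,
    expanded here along its first row. *)
Lemma dot_cross_gram (x y z u v w : 'cV[R]_3) :
  dot (cross x y) z * dot (cross u v) w =
  dot x u * (dot y v * dot z w - dot y w * dot z v)
  - dot x v * (dot y u * dot z w - dot y w * dot z u)
  + dot x w * (dot y u * dot z v - dot y v * dot z u).
Proof. by rewrite !dot_crossE !dotE; entries; ring. Qed.

Lemma dot_cross_cross x y :
  dot (cross x y) (cross x y) = dot x x * dot y y - dot x y ^+ 2.
Proof. by rewrite dot_crossE !mxE !I3_add !dotE; entries; ring. Qed.

Lemma dot_crossl x y : dot x (cross x y) = 0.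
Proof. by rewrite dotC dot_crossE; entries; ring. Qed.

Lemma dot_crossr x y : dot y (cross x y) = 0.
Proof. by rewrite dotC dot_crossE; entries; ring. Qed.

End Vectors.

(** * The first bracket as a bivector evaluated on gradients *)

Section PoissonTensor.
Variables (R : realType) (d : R) (I : 'I_3 -> R).
Local Notation phase := ('cV[R]_3 * 'cV[R]_3)%type.
Local Notation A := (Amx d I).

Definition pairing (p v : phase) : R := dot p.1 v.1 + dot p.2 v.2.

(** Only directional derivatives are recorded, since [bracket] is built from them alone. *)
Definition gradient (f : phase -> R) (z p : phase) : Prop :=
  forall v, is_derive z v f (pairing p v).

(** The part with [(g d I z.1)^-1] is the Lie-Poisson structure of e(3), rescaled; the last term is
    the gyroscopic correction of {M_i, M_j}. First components are gamma-gradients, second components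
    M-gradients. *)
Definition tensor (z p q : phase) : R :=
  (g d I z.1)^-1 * (dot (cross p.2 q.2) z.2 + dot (cross p.2 q.1) z.1
                    - dot (cross q.2 p.1) z.1)
  - d * g d I z.1 * dot z.2 (A *m z.1) * dot (cross p.2 q.2) z.1.

Lemma leviE :
  ((levi R 0 0 0 = 0) * (levi R 0 0 1 = 0) * (levi R 0 0 2 = 0)
   * (levi R 0 1 0 = 0) * (levi R 0 1 1 = 0) * (levi R 0 1 2 = 1)
   * (levi R 0 2 0 = 0) * (levi R 0 2 1 = -1) * (levi R 0 2 2 = 0)
   * (levi R 1 0 0 = 0) * (levi R 1 0 1 = 0) * (levi R 1 0 2 = -1)
   * (levi R 1 1 0 = 0) * (levi R 1 1 1 = 0) * (levi R 1 1 2 = 0)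
   * (levi R 1 2 0 = 1) * (levi R 1 2 1 = 0) * (levi R 1 2 2 = 0)
   * (levi R 2 0 0 = 0) * (levi R 2 0 1 = 1) * (levi R 2 0 2 = 0)
   * (levi R 2 1 0 = -1) * (levi R 2 1 1 = 0) * (levi R 2 1 2 = 0)
   * (levi R 2 2 0 = 0) * (levi R 2 2 1 = 0) * (levi R 2 2 2 = 0))%type.
Proof. by do !split; rewrite /levi !I3_add. Qed.

Lemma bracketE f h z p q : gradient f z p -> gradient h z q ->
  bracket d I f h z = tensor z p q.
Proof.
move=> fp hq.
have dME u k : gradient u z k -> forall i, dM i u z = k.2 i 0.
  move=> uk i; rewrite /dM; have [_ ->] := uk (0, delta_mx i 0).
  by rewrite /pairing /= dot_delta dotC dot0l add0r.
have dgamE u k : gradient u z k -> forall i, dgam i u z = k.1 i 0.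
  move=> uk i; rewrite /dgam; have [_ ->] := uk (delta_mx i 0, 0).
  by rewrite /pairing /= dot_delta (dotC k.2) dot0l addr0.
case: z fp hq dME dgamE => gam M fp hq dME dgamE.
rewrite /bracket /tensor !dot_crossE !big_I3 !(dME _ _ fp) !(dME _ _ hq).
rewrite !(dgamE _ _ fp) !(dgamE _ _ hq) /brMM /brMgam !big_I3 /=.
rewrite !leviE.
rewrite !mul0r !mulN1r !mul1r !addr0 !add0r.
move: (g d I gam) (dot M (A *m gam)) => r t.
entries.
ring.
Qed.

Lemma tensorDl (z p q r : phase) :
  tensor z (p + q) r = tensor z p r + tensor z q r.
Proof.
rewrite /tensor -[(p + q).1]/(p.1 + q.1) -[(p + q).2]/(p.2 + q.2).
by rewrite !crossDl !crossDr !dotDl; dots; ring.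
Qed.

Lemma tensorZl (z : phase) (c : R) (p q : phase) :
  tensor z (c *: p) q = c * tensor z p q.
Proof.
rewrite /tensor -[(c *: p).1]/(c *: p.1) -[(c *: p).2]/(c *: p.2).
by rewrite !crossZl !crossZr !dotZl; dots; ring.
Qed.

Lemma tensor_skew (z p q : phase) : tensor z p q = - tensor z q p.
Proof.
rewrite /tensor !(crossC q.2 p.2) -[- cross _ _]scaleN1r !dotZl; dots; ring.
Qed.

Lemma tensorDr (z p q r : phase) :
  tensor z r (p + q) = tensor z r p + tensor z r q.
Proof. by rewrite tensor_skew tensorDl opprD -!(tensor_skew z r). Qed.

Lemma tensorZr (z : phase) (c : R) (p q : phase) :
  tensor z q (c *: p) = c * tensor z q p.
Proof. by rewrite tensor_skew tensorZl -mulrN -tensor_skew. Qed.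

Lemma tensor_diag (z p : phase) : tensor z p p = 0.
Proof.
by have := tensor_skew z p p; move: (tensor z p p) => t tN; lra.
Qed.

End PoissonTensor.

(** * Directional derivatives of the coordinate functions *)

Section Derivatives.
Variable R : realType.

(** The difference quotient in the direction [v] equals [l v] for every nonzero step, so its limit
    is immediate. *)
Lemma is_derive_additive_homogeneous (V : normedModType R) (l : V -> R) z v :
  (forall h : R, l (h *: v + z) = h * l v + l z) -> is_derive z v l (l v).
Proof.
move=> lE.
have cl : (fun h => h^-1 *: ((l \o shift z) (h *: v) - l z)) @ 0^' --> l v.
  apply: cvg_near_cst; near=> h.
  have h0 : h != 0 by near: h; exact: nbhs_dnbhs_neq.
  by rewrite /= lE addrK /GRing.scale /= mulrA mulVf ?mul1r.
by apply: DeriveDef; [apply/cvg_ex; exists (l v) | exact: cvg_lim].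
Unshelve. all: by end_near. Qed.

Variables m n : nat.
Local Notation V := ('cV[R]_m * 'cV[R]_n)%type.

Lemma is_derive_fst_entry (z v : V) i :
  is_derive z v (fun w : V => w.1 i 0) (v.1 i 0).
Proof. by apply: is_derive_additive_homogeneous => h; rewrite /= !mxE. Qed.

Lemma is_derive_snd_entry (z v : V) i :
  is_derive z v (fun w : V => w.2 i 0) (v.2 i 0).
Proof. by apply: is_derive_additive_homogeneous => h; rewrite /= !mxE. Qed.

End Derivatives.

(** * Calculus rules for gradients *)

Section Gradients.
Variables (R : realType).
Local Notation phase := ('cV[R]_3 * 'cV[R]_3)%type.
Implicit Types (f h : phase -> R) (z p q : phase).

Lemma pairingD p q v : pairing (p + q) v = pairing p v + pairing q v.
Proof.
rewrite /pairing -[(p + q).1]/(p.1 + q.1) -[(p + q).2]/(p.2 + q.2) !dotDl.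
by rewrite addrACA.
Qed.

Lemma pairingZ (c : R) p v : pairing (c *: p) v = c * pairing p v.
Proof.
rewrite /pairing -[(c *: p).1]/(c *: p.1) -[(c *: p).2]/(c *: p.2) !dotZl.
by rewrite mulrDr.
Qed.

Lemma pairingN p v : pairing (- p) v = - pairing p v.
Proof. by rewrite -[in LHS]scaleN1r pairingZ mulN1r. Qed.

Lemma pairing_fst i (v : phase) : pairing (delta_mx i 0, 0) v = v.1 i 0.
Proof. by rewrite /pairing /= dotC dot_delta dot0l addr0. Qed.

Lemma pairing_snd i (v : phase) : pairing (0, delta_mx i 0) v = v.2 i 0.
Proof. by rewrite /pairing /= dot0l add0r dotC dot_delta. Qed.

Definition pairingE := (pairingD, pairingN, pairingZ, pairing_fst, pairing_snd).

(** Allows a gradient to be rewritten by a scalar computation against an arbitrary direction,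
    instead of an equality of vectors. *)
Lemma gradient_pairing f z p q :
  (forall v, pairing p v = pairing q v) -> gradient f z p -> gradient f z q.
Proof. by move=> pq fp v; rewrite -pq. Qed.

Lemma gradient_eq f z p q : gradient f z p -> p = q -> gradient f z q.
Proof. by move=> fp <-. Qed.

Lemma gradient_cst (c : R) z : gradient (fun=> c) z 0.
Proof.
move=> v; apply: is_derive_eq (is_derive_cst c z v) _.
by rewrite -(scale0r (0 : phase)) pairingZ mul0r.
Qed.

Lemma gradientD f h z p q : gradient f z p -> gradient h z q ->
  gradient (fun w => f w + h w) z (p + q).
Proof.
move=> fp hq v; have := is_deriveD (fp v) (hq v).
by rewrite pairingD.
Qed.

Lemma gradientM f h z p q : gradient f z p -> gradient h z q ->
  gradient (fun w => f w * h w) z (f z *: q + h z *: p).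
Proof.
move=> fp hq v; have := is_deriveM (fp v) (hq v).
by rewrite pairingD !pairingZ.
Qed.

Lemma gradientZ (c : R) f z p : gradient f z p ->
  gradient (fun w => c * f w) z (c *: p).
Proof.
move=> fp; apply: gradient_eq (gradientM (gradient_cst c z) fp) _.
by rewrite scaler0 addr0.
Qed.

Lemma gradientB f h z p q : gradient f z p -> gradient h z q ->
  gradient (fun w => f w - h w) z (p - q).
Proof.
move=> fp hq; have := gradientD fp (gradientZ (-1) hq).
by rewrite scaleN1r; under eq_fun do rewrite mulN1r.
Qed.

Lemma gradientV f z p : f z != 0 -> gradient f z p ->
  gradient (fun w => (f w)^-1) z (- (f z)^-2 *: p).
Proof.
move=> fz0 fp v; have [dfv dfE] := fp v.
apply: DeriveDef; first exact: derivableV.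
by rewrite deriveV // dfE pairingZ.
Qed.

Lemma gradient_near f h z p :
  (\near z, f z = h z) -> gradient f z p -> gradient h z p.
Proof. by move=> fh fp v; apply: near_eq_is_derive fh (fp v). Qed.

Lemma gradient_bilinear (c : 'I_3 -> R) (f h : 'I_3 -> phase -> R) z
    (p q : 'I_3 -> phase) :
  (forall i, gradient (f i) z (p i)) -> (forall i, gradient (h i) z (q i)) ->
  gradient (fun w => \sum_i c i * f i w * h i w) z
    (\sum_i (c i *: (f i z *: q i + h i z *: p i))).
Proof.
move=> fp hq; rewrite big_I3.
under eq_fun do rewrite big_I3 -!mulrA.
by do !apply: gradientD; apply/gradientZ/gradientM.
Qed.

Lemma gradient_fst z i : gradient (fun w => w.1 i 0) z (delta_mx i 0, 0).
Proof. by move=> v; rewrite pairing_fst; exact: is_derive_fst_entry. Qed.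

Lemma gradient_snd z i : gradient (fun w => w.2 i 0) z (0, delta_mx i 0).
Proof. by move=> v; rewrite pairing_snd; exact: is_derive_snd_entry. Qed.

Lemma continuous_fst_entry i : continuous (fun w : phase => w.1 i 0).
Proof.
move=> w; apply: (@continuous_comp _ _ _ fst (fun x : 'cV[R]_3 => x i 0)).
  exact: cvg_fst.
exact: coord_continuous.
Qed.

End Gradients.

(** * The forms N, J, alpha, tau, their gradients, and the two Hamiltonians in terms of them *)

Section QuadraticForms.
Variables (R : realType) (d : R) (I : 'I_3 -> R).
Local Notation phase := ('cV[R]_3 * 'cV[R]_3)%type.
Local Notation A := (Amx d I).
Local Notation a := (a d I).
Local Notation g := (g d I).
Implicit Types (z w : phase).

Definition inertia_gamma z : R := dot z.1 (A *m z.1).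
Definition inertia_M z : R := dot z.2 (A *m z.2).
Definition inertia_mixed z : R := dot z.1 (A *m z.2).
(** The quotient of (B_gamma M, M) - tau^2 by the Casimir function (gamma, M). *)
Definition cofactor_form z : R :=
  \sum_i (a (i + 1) * a (i + 2) - a i * (a (i + 1) + a (i + 2)))
    * z.1 i 0 * z.2 i 0.

Local Notation al := inertia_gamma.
Local Notation J := inertia_M.
Local Notation tau := inertia_mixed.
Local Notation ell := cofactor_form.

Lemma AmxE (x : 'cV[R]_3) i : (A *m x) i 0 = a i * x i 0.
Proof. exact: diag_mulE. Qed.

Lemma BmxE (x y : 'cV[R]_3) i : (Bmx d I x *m y) i 0 =
  (a i - a (i + 1)) * (a i - a (i + 2)) * x i 0 ^+ 2 * y i 0.
Proof. exact: diag_mulE. Qed.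

(* Modulo the Casimir function (gamma, M), the form of B_gamma is a square. *)
Lemma dot_BmxE z : dot (Bmx d I z.1 *m z.2) z.2 =
  tau z ^+ 2 + dot z.1 z.2 * ell z.
Proof.
rewrite /inertia_mixed /cofactor_form !dotE big_I3 !BmxE !AmxE !I3_add.
by entries; move: (a 0) (a 1) (a 2) => *; ring.
Qed.

Lemma dotmulZl (c : R) (B : 'M[R]_3) (x y : 'cV[R]_3) :
  dot ((c *: B) *m x) y = c * dot (B *m x) y.
Proof. by rewrite -scalemxAl dotZl. Qed.

Lemma HtE z : Ht d I z = 2^-1 * (J z - al z * dot z.2 z.2)
  + d * g z.1 ^+ 2 * (tau z ^+ 2 + dot z.1 z.2 * ell z).
Proof.
rewrite -dot_BmxE /Ht /Amx'; case: z => gam M /=.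
rewrite mulmxDl dotDl !dotmulZl mulmxBl dotBl.
by rewrite mul_scalar_mx dotZl (dotC (A *m M)).
Qed.

Lemma KtE z : Kt d I z = 4 * g z.1 ^+ 2 * tau z ^+ 2 *
  (dot z.2 z.2 - d * J z
   - d ^+ 2 * g z.1 ^+ 2 * (tau z ^+ 2 + dot z.1 z.2 * ell z)).
Proof.
rewrite -dot_BmxE /Kt; case: z => gam M /=.
by rewrite !mulmxBl !dotBl !dotmulZl mul1mx (dotC (A *m M)).
Qed.

Lemma g_sqE (x : 'cV[R]_3) : 0 < 1 - d * dot x (A *m x) ->
  g x ^+ 2 = (1 - d * dot x (A *m x))^-1.
Proof. by move=> x_gt0; rewrite exprVn sqr_sqrtr // ltW. Qed.

Definition grN z : phase := (0, 2 *: z.2).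
Definition grJ z : phase := (0, 2 *: (A *m z.2)).
Definition gral z : phase := (2 *: (A *m z.1), 0).
Definition grtau z : phase := (A *m z.2, A *m z.1).
(** Here [sig] stands for the Casimir function (gamma, M). *)
Definition grsig z : phase := (z.2, z.1).

Lemma scale_colE (c : R) (x : 'cV[R]_3) i : (c *: x) i 0 = c * x i 0.
Proof. by rewrite mxE. Qed.

Lemma zero_colE i : (0 : 'cV[R]_3) i 0 = 0.
Proof. by rewrite mxE. Qed.

Lemma gradient_N z : gradient (fun w => dot w.2 w.2) z (grN z).
Proof.
have -> : (fun w => dot w.2 w.2) =
    (fun w : phase => \sum_i 1 * w.2 i 0 * w.2 i 0).
  by apply/funext => w; apply: eq_bigr => i _; rewrite mul1r.
have := gradient_bilinear (fun=> 1) (gradient_snd z) (gradient_snd z).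
apply: gradient_pairing => v.
rewrite big_I3 !pairingE /pairing !dotE !scale_colE !zero_colE.
by entries; ring.
Qed.

Lemma gradient_J z : gradient J z (grJ z).
Proof.
have -> : J = (fun w => \sum_i a i * w.2 i 0 * w.2 i 0).
  by apply/funext => w; apply: eq_bigr => i _; rewrite AmxE mulrC.
have := gradient_bilinear a (gradient_snd z) (gradient_snd z).
apply: gradient_pairing => v.
rewrite big_I3 !pairingE /pairing !dotE !scale_colE !zero_colE !AmxE.
by entries; move: (a 0) (a 1) (a 2) => *; ring.
Qed.

Lemma gradient_al z : gradient al z (gral z).
Proof.
have -> : al = (fun w => \sum_i a i * w.1 i 0 * w.1 i 0).
  by apply/funext => w; apply: eq_bigr => i _; rewrite AmxE mulrC.
have := gradient_bilinear a (gradient_fst z) (gradient_fst z).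
apply: gradient_pairing => v.
rewrite big_I3 !pairingE /pairing !dotE !scale_colE !zero_colE !AmxE.
by entries; move: (a 0) (a 1) (a 2) => *; ring.
Qed.

Lemma gradient_tau z : gradient tau z (grtau z).
Proof.
have -> : tau = (fun w => \sum_i a i * w.1 i 0 * w.2 i 0).
  by apply/funext => w; apply: eq_bigr => i _; rewrite AmxE mulrCA mulrA.
have := gradient_bilinear a (gradient_fst z) (gradient_snd z).
apply: gradient_pairing => v.
rewrite big_I3 !pairingE /pairing !dotE !AmxE.
by entries; move: (a 0) (a 1) (a 2) => *; ring.
Qed.

Lemma gradient_sig z : gradient (fun w => dot w.1 w.2) z (grsig z).
Proof.
have -> : (fun w => dot w.1 w.2) =
    (fun w : phase => \sum_i 1 * w.1 i 0 * w.2 i 0).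
  by apply/funext => w; apply: eq_bigr => i _; rewrite mul1r.
have := gradient_bilinear (fun=> 1) (gradient_fst z) (gradient_snd z).
apply: gradient_pairing => v.
rewrite big_I3 !pairingE /pairing !dotE /=.
by entries; ring.
Qed.

End QuadraticForms.

(** * Involution with respect to the first bracket *)

Section FirstBracket.
Variables (R : realType) (d : R) (I : 'I_3 -> R).
Hypotheses (d_ge0 : 0 <= d) (I_gt0 : forall i, 0 < I i).
Local Notation phase := ('cV[R]_3 * 'cV[R]_3)%type.
Local Notation A := (Amx d I).
Local Notation a := (a d I).
Local Notation g := (g d I).
Local Notation N := (fun w : phase => dot w.2 w.2).
Local Notation al := (inertia_gamma d I).
Local Notation J := (inertia_M d I).
Local Notation tau := (inertia_mixed d I).
Local Notation ell := (cofactor_form d I).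
Local Notation tensor := (tensor d I).
Local Notation triple x y z := (dot (cross x y) z).

Lemma dot_sqr_gt0 (x : 'cV[R]_3) : x != 0 -> 0 < dot x x.
Proof.
move=> x0; rewrite lt_neqAle eq_sym sumr_ge0 ?andbT; last first.
  by move=> i _; rewrite -expr2 sqr_ge0.
apply: contraNneq x0 => /eqP; rewrite psumr_eq0; last first.
  by move=> i _; rewrite -expr2 sqr_ge0.
move=> /allP x0; apply/eqP/colP => i; rewrite mxE.
by apply/eqP; have := x0 i (mem_index_enum _); rewrite mulf_eq0 orbb.
Qed.

(** The quantity equals I_i / (I_i + d). *)
Lemma subr_da_gt0 i : 0 < 1 - d * a i.
Proof.
have Id_gt0 : 0 < I i + d by rewrite ltr_wpDr.
by rewrite subr_gt0 ltr_pdivrMr // mul1r ltrDr.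
Qed.

(** For a unit vector the left term 1 is (x, x), which makes the expression a positive definite
    diagonal form. It ensures that the square root in [g] is taken of a positive number. *)
Lemma subr_dal_gt0 (x : 'cV[R]_3) : dot x x = 1 -> 0 < 1 - d * dot x (A *m x).
Proof.
move=> x1.
have -> : 1 - d * dot x (A *m x) = \sum_i (1 - d * a i) * x i 0 ^+ 2.
  rewrite -[X in X - _ = _]x1 !dotE !AmxE big_I3.
  by entries; move: (a 0) (a 1) (a 2) => *; ring.
have [|x0] := eqVneq x 0.
  by move=> x0; move: x1; rewrite x0 dot0l => /esym/eqP; rewrite oner_eq0.
rewrite lt_neqAle eq_sym sumr_ge0 ?andbT; last first.
  by move=> i _; rewrite mulr_ge0 ?sqr_ge0 // ltW ?subr_da_gt0.
apply: contraNneq x0 => /eqP; rewrite psumr_eq0; last first.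
  by move=> i _; rewrite mulr_ge0 ?sqr_ge0 // ltW ?subr_da_gt0.
move=> /allP x0; apply/eqP/colP => i; rewrite mxE.
apply/eqP; have := x0 i (mem_index_enum _).
by rewrite mulf_eq0 (gt_eqF (subr_da_gt0 i)) /= sqrf_eq0.
Qed.

Section AtPoint.
Variable z : phase.
Hypotheses (gam1 : dot z.1 z.1 = 1) (gamM : dot z.1 z.2 = 0).
Local Notation gam := z.1.
Local Notation M := z.2.

(** Positivity of 1 - d alpha persists near the point by continuity; there g^2 is a rational
    function, to which the gradient rules apply. *)
Lemma g_near : \near z, (1 - d * al z)^-1 = g z.1 ^+ 2.
Proof.
have al_cts : (fun w => 1 - d * al w) @ z --> 1 - d * al z.
  have -> : al = (fun w : phase => w.1 0 0 * (a 0 * w.1 0 0)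
      + w.1 1 0 * (a 1 * w.1 1 0) + w.1 2 0 * (a 2 * w.1 2 0)).
    by apply/funext => w; rewrite /inertia_gamma dotE !AmxE.
  apply: cvgB (cvg_cst _) (cvgM (cvg_cst d) _).
  by do !apply: cvgD; apply: cvgM (cvgM (cvg_cst _) _);
    exact: continuous_fst_entry.
have : \near z, 0 < 1 - d * al z.
  by apply: (cvgr_gt _ al_cts); exact: subr_dal_gt0.
by apply: filterS => w w_gt0; rewrite g_sqE.
Qed.

Local Notation G := ((1 - d * al z)^-1).

Lemma gradient_g2 :
  gradient (fun w => g w.1 ^+ 2) z ((G ^+ 2 * d) *: gral d I z).
Proof.
apply: gradient_near g_near _.
have nz : 1 - d * al z != 0 by rewrite gt_eqF // subr_dal_gt0.
apply: gradient_eq (gradientV nz (gradientB (gradient_cst 1 z)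
  (gradientZ d (gradient_al d I z)))) _.
by rewrite sub0r scalerN scaleNr opprK scalerA -exprVn.
Qed.

Lemma gradient_beta : gradient (fun w => tau w ^+ 2 + dot w.1 w.2 * ell w) z
  ((2 * tau z) *: grtau d I z + ell z *: grsig z).
Proof.
(* The gradient of [ell] is multiplied by (gamma, M) = 0 in the product rule, so its existence
   suffices. *)
have gell : exists p, gradient ell z p.
  by eexists; apply: gradient_bilinear;
    [exact: gradient_fst|exact: gradient_snd].
have [p ellp] := gell.
have gt := gradientM (gradient_tau d I z) (gradient_tau d I z).
apply: gradient_eq (gradientD gt (gradientM (gradient_sig z) ellp)) _.
by rewrite gamM scale0r add0r -scalerDl mulr_natl mulr2n.
Qed.

(** The coefficient of [grsig z] may stay unspecified: a Casimir function contributes nothing to the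
    bracket. *)
Lemma gradient_Ht : exists c, gradient (Ht d I) z
  ((- (2^-1 * al z)) *: grN z + 2^-1 *: grJ d I z
   + (d ^+ 2 * G ^+ 2 * tau z ^+ 2 - 2^-1 * N z) *: gral d I z
   + (2 * d * G * tau z) *: grtau d I z + c *: grsig z).
Proof.
have -> : Ht d I = (fun w => 2^-1 * (J w - al w * N w)
    + d * (g w.1 ^+ 2 * (tau w ^+ 2 + dot w.1 w.2 * ell w))).
  by apply/funext => w; rewrite HtE mulrA.
exists (d * G * ell z).
have H1 := gradientZ 2^-1 (gradientB (gradient_J d I z)
  (gradientM (gradient_al d I z) (gradient_N z))).
have H2 := gradientZ d (gradientM gradient_g2 gradient_beta).
have := gradientD H1 H2; apply: gradient_pairing => v.
rewrite !pairingE gamM g_sqE ?subr_dal_gt0 //.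
rewrite -[dot z.1 (A *m z.1)]/(al z).
do 5![move: (pairing _ _) => ?].
move: (1 - d * al z)^-1 (al z) (tau z) (N z) (ell z) => *.
ring.
Qed.

Lemma gradient_Kt : exists c, gradient (Kt d I) z
  ((4 * G * tau z ^+ 2) *: grN z + (- (4 * d * G * tau z ^+ 2)) *: grJ d I z
   + (4 * d * G ^+ 2 * tau z ^+ 2
       * (N z - d * J z - 2 * d ^+ 2 * G * tau z ^+ 2)) *: gral d I z
   + (8 * G * tau z * (N z - d * J z - 2 * d ^+ 2 * G * tau z ^+ 2))
       *: grtau d I z + c *: grsig z).
Proof.
have -> : Kt d I = (fun w => 4 * (g w.1 ^+ 2 * (tau w * tau w)) *
    (N w - d * J w - d ^+ 2 * (g w.1 ^+ 2 *
      (tau w ^+ 2 + dot w.1 w.2 * ell w)))).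
  by apply/funext => w; rewrite KtE;
    move: (g w.1) (tau w) (N w) (J w) (ell w) (dot w.1 w.2) => *; ring.
exists (- 4 * d ^+ 2 * G ^+ 2 * tau z ^+ 2 * ell z).
have gt := gradientM (gradient_tau d I z) (gradient_tau d I z).
have H1 := gradientZ 4 (gradientM gradient_g2 gt).
have H2 := gradientB (gradientB (gradient_N z) (gradientZ d (gradient_J d I z)))
  (gradientZ (d ^+ 2) (gradientM gradient_g2 gradient_beta)).
have := gradientM H1 H2; apply: gradient_pairing => v.
rewrite !pairingE gamM g_sqE ?subr_dal_gt0 //.
rewrite -[dot z.1 (A *m z.1)]/(al z).
do 5![move: (pairing _ _) => ?].
move: (1 - d * al z)^-1 (al z) (tau z) (N z) (ell z) (J z) => *.
ring.
Qed.

Local Notation gN := (grN z).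
Local Notation gJ := (grJ d I z).
Local Notation gal := (gral d I z).
Local Notation gtau := (grtau d I z).
Local Notation e1 := (triple gam M (A *m gam)).
Local Notation e2 := (triple gam M (A *m M)).
Local Notation e3 := (triple gam (A *m M) (A *m gam)).
Local Notation e4 := (triple (A *m M) (A *m gam) M).

Ltac tensor_calc :=
  rewrite /tensor /= /inertia_mixed !dot_crossE !dotE ?scale_colE ?zero_colE
    !AmxE;
  move: (g z.1) => r; entries; move: (a 0) (a 1) (a 2) => *; ring.

Lemma tensor_NJ : tensor z gN gJ = - 4 * d * g gam * tau z * e2.
Proof. tensor_calc. Qed.

Lemma tensor_Nal : tensor z gN gal = 4 * (g gam)^-1 * e1.
Proof. tensor_calc. Qed.

Lemma tensor_Ntau : tensor z gN gtau =
  2 * (g gam)^-1 * e2 - 2 * d * g gam * tau z * e1.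
Proof. tensor_calc. Qed.

Lemma tensor_Jal : tensor z gJ gal = 4 * (g gam)^-1 * e3.
Proof. tensor_calc. Qed.

Lemma tensor_Jtau : tensor z gJ gtau =
  2 * (g gam)^-1 * e4 - 2 * d * g gam * tau z * e3.
Proof. tensor_calc. Qed.

(** The gamma-gradient of alpha is parallel to the M-gradient of tau, and alpha does not depend on
    M. *)
Lemma tensor_altau : tensor z gal gtau = 0.
Proof. tensor_calc. Qed.

(** The gradient of (gamma, M) lies in the kernel of the bivector; this discards the unspecified
    coefficients in the gradients of H~ and K~. *)
Lemma tensor_sig p : tensor z (grsig z) p = 0.
Proof. tensor_calc. Qed.

Lemma tauC : dot M (A *m gam) = tau z.
Proof.
rewrite /inertia_mixed !dotE !AmxE.
by entries; move: (a 0) (a 1) (a 2) => *; ring.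
Qed.

(** Multiply [e3] by the triple product of gamma, M, L, which is (L, L) = N on the level set; since
    gamma is a unit vector orthogonal to M and L, the Gram determinant reduces to a 2x2 minor. *)
Lemma triple_gam : N z * e3 = J z * e1 - tau z * e2.
Proof.
have := dot_cross_gram gam (A *m M) (A *m gam) gam M (cross gam M).
rewrite dot_cross_cross dot_crossl gam1 gamM.
rewrite !(dotC (A *m _)) -/(al z) -/(J z) -/(tau z).
rewrite tauC.
rewrite !(dotC (cross gam M)).
dots; move: (J z) (tau z) (al z) => * ; lra.
Qed.

(** The same Gram argument in the frame gamma, M, L, now with M as one of the vectors; the common
    factor N is cancelled. *)
Lemma triple_M : N z != 0 -> e4 = al z * e2 - tau z * e1.
Proof.
move=> N0; apply: (mulIf N0).
have := dot_cross_gram (A *m M) (A *m gam) M gam M (cross gam M).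
rewrite dot_cross_cross dot_crossr gam1 gamM (dotC M gam) gamM.
rewrite !(dotC (A *m _)) -/(al z) -/(J z) -/(tau z).
rewrite tauC.
rewrite !(dotC (cross gam M)) expr0n subr0 mul1r => ->.
dots; move: (J z) (tau z) (al z) => *; ring.
Qed.

Lemma bracket_Ht_Kt : bracket d I (Ht d I) (Kt d I) z = 0.
Proof.
have [cH gH] := gradient_Ht; have [cK gK] := gradient_Kt.
rewrite (bracketE d I gH gK).
rewrite !(tensorDl, tensorDr, tensorZl, tensorZr).
rewrite !tensor_sig !tensor_diag.
rewrite !(tensor_skew _ _ _ _ (grsig z)) !tensor_sig.
(* Skew-symmetry leaves only brackets in the order N, J, alpha, tau. *)
rewrite (tensor_skew _ _ _ gJ gN) (tensor_skew _ _ _ gal gN).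
rewrite (tensor_skew _ _ _ gtau gN) (tensor_skew _ _ _ gal gJ).
rewrite (tensor_skew _ _ _ gtau gJ) (tensor_skew _ _ _ gtau gal).
rewrite tensor_NJ tensor_Nal tensor_Ntau tensor_Jal tensor_Jtau tensor_altau.
(* The reduction of [e3] divides by N, so M = 0 is treated apart; there tau, J and N all vanish. *)
have [M0|/dot_sqr_gt0 N_gt0] := eqVneq M 0.
  have E0 x : dot x M = 0 by rewrite M0 dotC dot0l.
  have t0 : tau z = 0.
    by rewrite /inertia_mixed M0 mulmx0 dotC dot0l.
  have J0 : J z = 0 by rewrite /inertia_M dotC E0.
  by rewrite t0 J0 E0; move: e1 e2 e3 e4 => *; ring.
have N0 : N z != 0 by rewrite gt_eqF.
have -> : e3 = (J z * e1 - tau z * e2) / N z by rewrite -triple_gam mulrC mulKf.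
rewrite triple_M //.
have D_gt0 := subr_dal_gt0 gam1.
have g_gt0 : g gam != 0.
  by rewrite invr_eq0 gt_eqF // sqrtr_gt0.
(* Every basic bracket is linear in g and 1/g. Writing g as G / g with G = 1 / (1 - d alpha) makes
   1/g a common factor and the remaining identity rational. *)
have gE : g gam = (1 - d * al z)^-1 * (g gam)^-1.
  by rewrite -[LHS](mulfK g_gt0) -expr2 g_sqE.
have D0 : 1 - d * al z != 0 by rewrite gt_eqF.
move: gE D0 N0 {g_gt0}; move: (g gam) (g gam)^-1 => gg r ->.
move: e1 e2 (N z) (J z) (tau z) (al z) => x1 x2 n j t al0 D0 N0.
field.
by rewrite D0 N0.
Qed.

End AtPoint.
End FirstBracket.

(** * Spheroconical coordinates of a vector L and the associated momenta, over any field *)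

Section SpheroconicalCoordinates.
Variable F : fieldType.
Variables a0 a1 a2 d : F.
Hypotheses (a01 : a0 - a1 != 0) (a12 : a1 - a2 != 0) (a20 : a2 - a0 != 0).
Variables L0 L1 L2 N u1 u2 : F.

(** These are the residues in the partial fraction expansion of N (u - u1) (u - u2) / ((u - a0) (u -
    a1) (u - a2)) as the sum of the L_i^2 / (u - a_i). *)
Definition sphero_rel :=
  [/\ L0 ^+ 2 = N * ((u1 - a0) * (u2 - a0)) / ((a1 - a0) * (a2 - a0)),
      L1 ^+ 2 = N * ((u1 - a1) * (u2 - a1)) / ((a2 - a1) * (a0 - a1)) &
      L2 ^+ 2 = N * ((u1 - a2) * (u2 - a2)) / ((a0 - a2) * (a1 - a2))].

Let a10 : a1 - a0 != 0. Proof. by rewrite -opprB oppr_eq0. Qed.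
Let a21 : a2 - a1 != 0. Proof. by rewrite -opprB oppr_eq0. Qed.
Let a02 : a0 - a2 != 0. Proof. by rewrite -opprB oppr_eq0. Qed.

(** The three fractions multiplying c sum to 1, so c is forced to be the squared length of L. *)
Lemma sphero_rel_proportional (c : F) :
  L0 ^+ 2 + L1 ^+ 2 + L2 ^+ 2 = N ->
  L0 ^+ 2 = c * ((u1 - a0) * (u2 - a0)) / ((a1 - a0) * (a2 - a0)) ->
  L1 ^+ 2 = c * ((u1 - a1) * (u2 - a1)) / ((a2 - a1) * (a0 - a1)) ->
  L2 ^+ 2 = c * ((u1 - a2) * (u2 - a2)) / ((a0 - a2) * (a1 - a2)) ->
  sphero_rel.
Proof.
move=> LN h0 h1 h2; suff cN : c = N by rewrite /sphero_rel -cN.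
by rewrite -LN h0 h1 h2; field; rewrite a01 a12 a20 a10 a21 a02.
Qed.

(** Together with [sphero_prod], this compares coefficients in the numerator of the partial fraction
    expansion. *)
Lemma sphero_sum : sphero_rel ->
  L0 ^+ 2 * (a1 + a2) + L1 ^+ 2 * (a2 + a0) + L2 ^+ 2 * (a0 + a1)
  = N * (u1 + u2).
Proof.
by case=> -> -> ->; field; rewrite a01 a12 a20 a10 a21 a02.
Qed.

Lemma sphero_prod : sphero_rel ->
  L0 ^+ 2 * (a1 * a2) + L1 ^+ 2 * (a2 * a0) + L2 ^+ 2 * (a0 * a1)
  = N * (u1 * u2).
Proof.
by case=> -> -> ->; field; rewrite a01 a12 a20 a10 a21 a02.
Qed.

Lemma sphero_neq : L0 != 0 -> L1 != 0 -> L2 != 0 -> sphero_rel ->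
  [/\ a0 - u1 != 0, a1 - u1 != 0 & a2 - u1 != 0].
Proof.
have nz (x y z w : F) :
    x != 0 -> x ^+ 2 = N * ((u1 - y) * z) / w -> y - u1 != 0.
  move=> x0 xE; apply: contra x0; rewrite -opprB oppr_eq0 => /eqP y0.
  by move/eqP: xE; rewrite y0 mul0r mulr0 mul0r sqrf_eq0.
by move=> l0 l1 l2 [/(nz _ _ _ _ l0) ? /(nz _ _ _ _ l1) ? /(nz _ _ _ _ l2)].
Qed.

Lemma sphero_root : L0 != 0 -> L1 != 0 -> L2 != 0 -> sphero_rel ->
  L0 ^+ 2 / (a0 - u1) + L1 ^+ 2 / (a1 - u1) + L2 ^+ 2 / (a2 - u1) = 0.
Proof.
move=> l0 l1 l2 rel; have [n0 n1 n2] := sphero_neq l0 l1 l2 rel.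
case: rel => -> -> ->; field.
by rewrite a01 a12 a20 a10 a21 a02 n0 n1 n2.
Qed.

(* Cauchy-Binet for the form of (A - u)^-1 and the pair of vectors x, L. *)
Lemma resolvent_gram (x0 x1 x2 u : F) :
  a0 - u != 0 -> a1 - u != 0 -> a2 - u != 0 ->
  (x0 ^+ 2 / (a0 - u) + x1 ^+ 2 / (a1 - u) + x2 ^+ 2 / (a2 - u))
    * (L0 ^+ 2 / (a0 - u) + L1 ^+ 2 / (a1 - u) + L2 ^+ 2 / (a2 - u))
  - (x0 * L0 / (a0 - u) + x1 * L1 / (a1 - u) + x2 * L2 / (a2 - u)) ^+ 2
  = ((x1 * L2 - x2 * L1) ^+ 2 * (a0 - u) + (x2 * L0 - x0 * L2) ^+ 2 * (a1 - u)
     + (x0 * L1 - x1 * L0) ^+ 2 * (a2 - u)) / ((a0 - u) * (a1 - u) * (a2 - u)).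
Proof. by move=> n0 n1 n2; field; rewrite n0 n1 n2. Qed.

(** Two of the three momentum relations form a linear system for p1 and p2. Eliminating p2 leaves
    terms with weights 1 - d a_i, which [sphero_rel] and the orthogonality of L and x bring to
    resolvent form. *)
Lemma momentum_eq (x0 x1 x2 p1 p2 r : F) (two0 : 2 != 0 :> F) :
  L0 != 0 -> L1 != 0 -> L2 != 0 -> u1 - u2 != 0 -> 1 - d * u1 != 0 ->
  sphero_rel -> L0 * x0 + L1 * x1 + L2 * x2 = 0 ->
  2 * (a1 - a2) * (L1 * L2) *
    ((a0 - u1) * (1 - d * u1) * p1 - (a0 - u2) * (1 - d * u2) * p2) =
  r * N * (u1 - u2) *
    (x2 * L1 * (1 - d * a2) - x1 * L2 * (1 - d * a1)) ->
  2 * (a2 - a0) * (L2 * L0) *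
    ((a1 - u1) * (1 - d * u1) * p1 - (a1 - u2) * (1 - d * u2) * p2) =
  r * N * (u1 - u2) *
    (x0 * L2 * (1 - d * a0) - x2 * L0 * (1 - d * a2)) ->
  2 * p1 =
  r * (x0 * L0 / (a0 - u1) + x1 * L1 / (a1 - u1) + x2 * L2 / (a2 - u1)).
Proof.
move=> l0 l1 l2 u12 k1 rel Lx e0 e1.
have [n0 n1 n2] := sphero_neq l0 l1 l2 rel.
set E0 := (X in _ * X = _) in e0; set E1 := (X in _ * X = _) in e1.
have {}e0 : E0 = r * N * (u1 - u2) *
    (x2 * (1 - d * a2) / L2 - x1 * (1 - d * a1) / L1)
    / (2 * (a1 - a2)).
  apply: (@mulfI _ (2 * (a1 - a2) * (L1 * L2))); first by rewrite !mulf_neq0.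
  by rewrite e0; field; rewrite ?two0 ?a12 ?l1 ?l2.
have {}e1 : E1 = r * N * (u1 - u2) *
    (x0 * (1 - d * a0) / L0 - x2 * (1 - d * a2) / L2)
    / (2 * (a2 - a0)).
  apply: (@mulfI _ (2 * (a2 - a0) * (L2 * L0))); first by rewrite !mulf_neq0.
  by rewrite e1; field; rewrite ?two0 ?a20 ?l0 ?l2.
(* This combination of the two relations cancels p2. *)
have comb : E0 * (a1 - u2) - E1 * (a0 - u2) =
    (a0 - a1) * (u1 - u2) * (1 - d * u1) * p1 by rewrite /E0 /E1; ring.
have c2 : 2 * (1 - d * u1) * p1 = r *
  (x0 * (1 - d * a0) / L0 * (N * (a0 - u2) / ((a0 - a1) * (a0 - a2)))
   + x1 * (1 - d * a1) / L1 * (N * (a1 - u2) / ((a1 - a0) * (a1 - a2)))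
   + x2 * (1 - d * a2) / L2 * (N * (a2 - u2) / ((a2 - a0) * (a2 - a1)))).
  apply: (@mulfI _ ((a0 - a1) * (u1 - u2))); first by rewrite mulf_neq0.
  rewrite -[LHS]mulrA.
  transitivity (2 * (E0 * (a1 - u2) - E1 * (a0 - u2))).
    by rewrite comb; ring.
  rewrite e0 e1; move: (1 - d * a0) (1 - d * a1) (1 - d * a2) => w0 w1 w2.
  by field; rewrite ?two0 ?l0 ?l1 ?l2 ?a01 ?a12 ?a20 ?a10 ?a21 ?a02.
have [h0 h1 h2] := rel.
(* Removing the factor a_i - u1 from the relation for L_i^2 produces the resolvent denominators. *)
have f0 : N * (a0 - u2) / ((a0 - a1) * (a0 - a2)) = L0 ^+ 2 / (a0 - u1).
  by rewrite h0; field; rewrite ?n0 ?a01 ?a12 ?a20 ?a10 ?a21 ?a02.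
have f1 : N * (a1 - u2) / ((a1 - a0) * (a1 - a2)) = L1 ^+ 2 / (a1 - u1).
  by rewrite h1; field; rewrite ?n1 ?a01 ?a12 ?a20 ?a10 ?a21 ?a02.
have f2 : N * (a2 - u2) / ((a2 - a0) * (a2 - a1)) = L2 ^+ 2 / (a2 - u1).
  by rewrite h2; field; rewrite ?n2 ?a01 ?a12 ?a20 ?a10 ?a21 ?a02.
apply: (mulfI k1).
transitivity (2 * (1 - d * u1) * p1); first by ring.
rewrite c2 f0 f1 f2.
(* 1 - d a = (1 - d u) - d (a - u), and (L, x) = 0. *)
transitivity (r * ((1 - d * u1) *
    (x0 * L0 / (a0 - u1) + x1 * L1 / (a1 - u1) + x2 * L2 / (a2 - u1))
  - d * (L0 * x0 + L1 * x1 + L2 * x2))).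
  by field; rewrite ?n0 ?n1 ?n2 ?l0 ?l1 ?l2.
by rewrite Lx mulr0 subr0; ring.
Qed.

End SpheroconicalCoordinates.

(** * The tilde coordinates as spheroconical coordinates of L, and the Hamiltonians as functions of
    the lambda_k *)

Lemma I3_case (P : 'I_3 -> Prop) : P 0 -> P 1 -> P 2 -> forall i, P i.
Proof.
move=> P0 P1 P2 [[|[|[|//]]] i3].
- by have -> : Ordinal i3 = 0 by exact: val_inj.
- by have -> : Ordinal i3 = 1 by exact: val_inj.
- by have -> : Ordinal i3 = 2 by exact: val_inj.
Qed.

(** Here [xj] and [xk] are two of the gamma~, and [wj], [wk] the weights 1 - d a. Multiplying the
    momentum relation by [xj * xk] leaves only their squares, which are known through L; the sign
    choices thereby drop out. *)
Lemma momentum_clear_roots (F : fieldType)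
    (r rt xj xk ci cj ck Mi Mj Mk Lj Lk wj wk N u b E : F) :
  xj != 0 -> xk != 0 -> wj != 0 -> wk != 0 -> rt != 0 -> N != 0 -> u != 0 ->
  Lj != 0 -> Lk != 0 ->
  xj ^+ 2 = Lj ^+ 2 / (wj * rt ^+ 2 * N) ->
  xk ^+ 2 = Lk ^+ 2 / (wk * rt ^+ 2 * N) ->
  Lj = ck * Mi - ci * Mk -> Lk = ci * Mj - cj * Mi ->
  r / rt * (- ((xj ^+ 2 + xk ^+ 2) * cj * ck * Mi / (xj * xk))
            + ci * xj * ck * Mj / xk + ci * cj * xk * Mk / xj)
  = 2 * xj * xk * b * rt / u * E ->
  2 * b * (Lj * Lk) * E = r * N * u * (ck * Lj * wk - cj * Lk * wj).
Proof.
move=> xj0 xk0 wj0 wk0 rt0 N0 u0 Lj0 Lk0 hj hk LjE LkE eqE.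
have {}eqE : r / rt * (xj ^+ 2 * ck * Lk - xk ^+ 2 * cj * Lj)
    = 2 * xj ^+ 2 * xk ^+ 2 * b * rt / u * E.
  transitivity (xj * xk * (2 * xj * xk * b * rt / u * E)); last by field.
  by rewrite -eqE LjE LkE; field; rewrite ?xj0 ?xk0 ?rt0.
rewrite hj hk in eqE.
have c0 : r * N * u * (ck * Lj * wk - cj * Lk * wj) =
  wj * wk * rt ^+ 2 * N ^+ 2 * rt * u / (Lj * Lk) * (r / rt *
    (Lj ^+ 2 / (wj * rt ^+ 2 * N) * ck * Lk
     - Lk ^+ 2 / (wk * rt ^+ 2 * N) * cj * Lj)).
  by field; rewrite ?Lj0 ?Lk0 ?wj0 ?wk0 ?rt0 ?N0.
by rewrite c0 eqE; field; rewrite ?Lj0 ?Lk0 ?wj0 ?wk0 ?rt0 ?N0 ?u0.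
Qed.

Section TildeCoordinates.
Variables (R : realType) (d : R) (I : 'I_3 -> R).
Hypotheses (d_ge0 : 0 <= d) (I_gt0 : forall i, 0 < I i) (I_inj : injective I).
Local Notation A := (Amx d I).
Local Notation a := (a d I).
Local Notation g := (g d I).

Lemma a_inj : injective a.
Proof. by move=> i j /invr_inj/addIr/I_inj. Qed.

Lemma a_sub_neq0 i j : i != j -> a i - a j != 0.
Proof. by move=> ij; rewrite subr_eq0 (inj_eq a_inj). Qed.

Variables (gam M gt : 'cV[R]_3) (ut pt : 'cV[R]_2).
Hypotheses (gam1 : dot gam gam = 1) (gamM : dot gam M = 0) (M0 : M != 0).
Hypotheses (gt_rel : gamt_rel d I gam M gt) (ut_rel : u_rel d I gt ut).
Hypothesis pt_rel : p_rel d I gt (Mt d I gam M gt) ut pt.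
Local Notation N := (dot M M).
Local Notation L := (cross gam M).
Local Notation u1 := (ut 0 0).
Local Notation u2 := (ut 1 0).
Local Notation p1 := (pt 0 0).
Local Notation p2 := (pt 1 0).
Local Notation z := (gam, M).
Local Notation al := (inertia_gamma d I).
Local Notation J := (inertia_M d I).
Local Notation tau := (inertia_mixed d I).

Let N0 : N != 0. Proof. by rewrite gt_eqF // dot_sqr_gt0. Qed.
Let w0 i : 1 - d * a i != 0. Proof. by rewrite gt_eqF // subr_da_gt0. Qed.

(** With the convention that the inverse of 0 is 0, vanishing of g~ would force gamma~_1 = 0 through
    its defining relation. *)
Lemma gt_norm_neq0 : g gt != 0.
Proof.
have [gt0 gtE _] := gt_rel; apply: contraNneq (gt0 0) => g0.
by rewrite -sqrf_eq0 gtE g0 expr0n mulr0 invr0 mul0r.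
Qed.

(** The vectors gamma, M / |M|, L / |M| are orthonormal, so their i-th entries have squares summing
    to 1. *)
Lemma cross_sqr i : L i 0 ^+ 2 = N - N * gam i 0 ^+ 2 - M i 0 ^+ 2.
Proof.
have -> : L i 0 ^+ 2 = dot gam gam * (N - M i 0 ^+ 2) - N * gam i 0 ^+ 2
    - dot gam M ^+ 2 + 2 * dot gam M * gam i 0 * M i 0.
  by move: i; apply: I3_case; rewrite !mxE !I3_add !dotE; entries; ring.
rewrite gam1 gamM; entries; move: (dot _ _) => *; ring.
Qed.

(** The bracket in the definition of gamma~_i^2 is - L_i^2 / N; its sign cancels against that of a_i
    d - 1. *)
Lemma gt_sqr i :
  gt i 0 ^+ 2 = L i 0 ^+ 2 / ((1 - d * a i) * g gt ^+ 2 * N).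
Proof.
have [_ gtE _] := gt_rel; have rt0 := gt_norm_neq0.
have -> : L i 0 ^+ 2 = M (i + 1) 0 ^+ 2 + M (i + 2) 0 ^+ 2 - N * gam i 0 ^+ 2.
  rewrite cross_sqr; move: i; apply: I3_case; rewrite !I3_add !dotE;
  by entries; ring.
rewrite gtE gam1.
have -> : a i * d - 1 = - (1 - d * a i) by ring.
have := w0 i; have := N0; move: (1 - d * a i) N (g gt) rt0 => w n r r0 n0 w_0.
by entries; field; rewrite ?r0 ?n0 ?w_0.
Qed.

Lemma cross_neq0 i : L i 0 != 0.
Proof.
have [gt0 _ _] := gt_rel; apply: contraNneq (gt0 i) => L0.
by rewrite -sqrf_eq0 gt_sqr L0 expr0n mul0r.
Qed.

Lemma cross_norm : L 0 0 ^+ 2 + L 1 0 ^+ 2 + L 2 0 ^+ 2 = N.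
Proof.
have := dot_cross_cross gam M; rewrite gam1 gamM mul1r expr0n subr0 => <-.
by rewrite dotE !expr2.
Qed.

(** The weight 1 - d a_i separating gamma~_i^2 from L_i^2 completes the two weights in [u_rel] to a
    product independent of i. Both orders of the roots are allowed, so that facts about the first
    root apply to either. *)
Lemma tilde_sphero (v1 v2 : R) :
  (v1 = u1 /\ v2 = u2) \/ (v1 = u2 /\ v2 = u1) ->
  sphero_rel (a 0) (a 1) (a 2) (L 0 0) (L 1 0) (L 2 0) N v1 v2.
Proof.
move=> v12; have [_ k1 k2 uE] := ut_rel; have rt0 := gt_norm_neq0.
pose c := g gt ^+ 2 * N * ((1 - d * a 0) * (1 - d * a 1) * (1 - d * a 2))
  / ((1 - d * u1) * (1 - d * u2)).
have LE i : L i 0 ^+ 2 = c * ((v1 - a i) * (v2 - a i))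
    / ((a (i + 1) - a i) * (a (i + 2) - a i)).
  have -> : (v1 - a i) * (v2 - a i) = (u1 - a i) * (u2 - a i).
    by case: v12 => -[-> ->] //; rewrite mulrC.
  have -> : L i 0 ^+ 2 = gt i 0 ^+ 2 * ((1 - d * a i) * g gt ^+ 2 * N).
    by rewrite gt_sqr divfK // !mulf_neq0 // sqrf_eq0.
  rewrite uE /c.
  have -> : (1 - d * a 0) * (1 - d * a 1) * (1 - d * a 2) =
      (1 - d * a i) * (1 - d * a (i + 1)) * (1 - d * a (i + 2)).
    move: i; apply: I3_case; rewrite !I3_add;
    by move: (a 0) (a 1) (a 2) => *; ring.
  rewrite invfM.
  move: ((1 - d * u1) * (1 - d * u2))^-1 => y1.
  move: ((a (i + 1) - a i) * (a (i + 2) - a i))^-1 => y2.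
  move: (1 - d * u1)^-1 (1 - d * u2)^-1 => y3 y4.
  move: (1 - d * a i) (1 - d * a (i + 1)) (1 - d * a (i + 2)) (g gt) N => *.
  move: (a i) => *; entries; ring.
apply: (@sphero_rel_proportional _ _ _ _ _ _ _ _ _ _ _ _ _ c).
all: rewrite ?a_sub_neq0 ?cross_norm // LE !I3_add //.
Qed.

Lemma tilde_momentum :
  2 * p1 = g gam * (gam 0 0 * L 0 0 / (a 0 - u1) + gam 1 0 * L 1 0 / (a 1 - u1)
                    + gam 2 0 * L 2 0 / (a 2 - u1)) /\
  2 * p2 = g gam * (gam 0 0 * L 0 0 / (a 0 - u2) + gam 1 0 * L 1 0 / (a 1 - u2)
                    + gam 2 0 * L 2 0 / (a 2 - u2)).
Proof.
have [u12 k1 k2 _] := ut_rel; have rt0 := gt_norm_neq0.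
have [gt0 _ _] := gt_rel.
have E (i : 'I_3) : 2 * (a (i + 1) - a (i + 2)) * (L (i + 1) 0 * L (i + 2) 0) *
    ((a i - u1) * (1 - d * u1) * p1 - (a i - u2) * (1 - d * u2) * p2) =
  g gam * N * (u1 - u2) *
    (gam (i + 2) 0 * L (i + 1) 0 * (1 - d * a (i + 2))
     - gam (i + 1) 0 * L (i + 2) 0 * (1 - d * a (i + 1))).
  have iE : ((i + 1 + 1 = i + 2)%R * (i + 1 + 2 = i)%R * (i + 2 + 1 = i)%R
      * (i + 2 + 2 = i + 1)%R)%type.
    by move: i; apply: I3_case; rewrite !I3_add.
  apply: (@momentum_clear_roots _ (g gam) (g gt) (gt (i + 1) 0) (gt (i + 2) 0)
    (gam i 0) _ _ (M i 0) (M (i + 1) 0) (M (i + 2) 0))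
    (gt_sqr _) (gt_sqr _) _ _ _ => //.
  - by rewrite subr_eq0.
  - exact: cross_neq0.
  - exact: cross_neq0.
  - by rewrite mxE !iE.
  - by rewrite mxE !iE.
  - have := pt_rel i; rewrite mxE; cbv zeta => ->.
    move: (g gt) (a i) (a (i + 1)) (a (i + 2)) (u1 - u2)^-1 => *.
    by entries; ring.
have Lx : L 0 0 * gam 0 0 + L 1 0 * gam 1 0 + L 2 0 * gam 2 0 = 0.
  by rewrite -dotE dotC dot_crossl.
have := E 0; have := E 1; rewrite !I3_add => E1 E0.
have two0 : 2 != 0 :> R by rewrite pnatr_eq0.
have a01 := a_sub_neq0 (isT : (0 : 'I_3) != 1).
have a12 := a_sub_neq0 (isT : (1 : 'I_3) != 2).
have a20 := a_sub_neq0 (isT : (2 : 'I_3) != 0).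
(* Exchanging the two pairs (u~_k, p~_k) changes the sign of both sides of the momentum relations,
   so [momentum_eq] also yields the second momentum. *)
have swap (x y b c v w t : R) : x * (b - c) = y * (v - w) * t ->
    x * (c - b) = y * (w - v) * t.
  by move=> h; rewrite -opprB mulrN h; ring.
have mom := momentum_eq a01 a12 a20 two0
  (cross_neq0 0) (cross_neq0 1) (cross_neq0 2).
split.
  apply: mom k1 (tilde_sphero (or_introl (conj erefl erefl))) Lx E0 E1.
  by rewrite subr_eq0.
apply: mom k2 (tilde_sphero (or_intror (conj erefl erefl))) Lx
  (swap _ _ _ _ _ _ _ E0) (swap _ _ _ _ _ _ _ E1).
by rewrite subr_eq0 eq_sym.
Qed.

(** In [resolvent_gram] with x = gamma the root condition kills the product of the two forms, while
    gamma x L = - M turns the right-hand numerator into J - u N. This gives the square of 2 p /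
    g. *)
Lemma lambda_expr (p u : R) :
  2 * p = g gam * (gam 0 0 * L 0 0 / (a 0 - u) + gam 1 0 * L 1 0 / (a 1 - u)
                    + gam 2 0 * L 2 0 / (a 2 - u)) ->
  a 0 - u != 0 -> a 1 - u != 0 -> a 2 - u != 0 ->
  L 0 0 ^+ 2 / (a 0 - u) + L 1 0 ^+ 2 / (a 1 - u) + L 2 0 ^+ 2 / (a 2 - u)
    = 0 ->
  4 * (d * u - 1) * (a 0 - u) * (a 1 - u) * (a 2 - u) * p ^+ 2
  = g gam ^+ 2 * (1 - d * u) * (J z - u * N).
Proof.
move=> pE n0 n1 n2 root.
have := resolvent_gram (L 0 0) (L 1 0) (L 2 0) (gam 0 0) (gam 1 0) (gam 2 0)
  n0 n1 n2.
rewrite root mulr0 sub0r.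
set S := (X in - X ^+ 2 = _); rewrite -/S in pE => SE.
(* gam x (gam x M) = - M *)
have ME : (gam 1 0 * L 2 0 - gam 2 0 * L 1 0) ^+ 2 * (a 0 - u)
    + (gam 2 0 * L 0 0 - gam 0 0 * L 2 0) ^+ 2 * (a 1 - u)
    + (gam 0 0 * L 1 0 - gam 1 0 * L 0 0) ^+ 2 * (a 2 - u) = J z - u * N.
  have crE i : cross gam L i 0 = - M i 0.
    have -> : cross gam L i 0 = dot gam M * gam i 0 - dot gam gam * M i 0.
      move: i; apply: I3_case; rewrite !mxE !I3_add !dotE;
      by entries; ring.
    by rewrite gamM gam1; entries; ring.
  have := crE 0; have := crE 1; have := crE 2.
  rewrite ![cross gam L _ _]mxE !I3_add => -> -> ->.
  rewrite /inertia_M /= !dotE !AmxE.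
  by move: (a 0) (a 1) (a 2) => *; entries; ring.
rewrite ME in SE.
have {}SE : S ^+ 2 * ((a 0 - u) * (a 1 - u) * (a 2 - u)) = - (J z - u * N).
  by rewrite -[S ^+ 2]opprK SE mulNr divfK // !mulf_neq0.
have -> : 4 * (d * u - 1) * (a 0 - u) * (a 1 - u) * (a 2 - u) * p ^+ 2
  = (d * u - 1) * (2 * p) ^+ 2 * ((a 0 - u) * (a 1 - u) * (a 2 - u)).
  by move: (a 0) (a 1) (a 2) => *; ring.
rewrite pE exprMn.
transitivity ((d * u - 1) * g gam ^+ 2
  * (S ^+ 2 * ((a 0 - u) * (a 1 - u) * (a 2 - u)))).
  by move: (a 0) (a 1) (a 2) (g gam) {pE SE}S => *; ring.
by rewrite SE; move: (J z) N (g gam) => *; ring.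
Qed.

Lemma tilde_lambda k : lambda d I k (ut, pt)
  = g gam ^+ 2 * (1 - d * ut k 0) * (J z - ut k 0 * N).
Proof.
have a01 := a_sub_neq0 (isT : (0 : 'I_3) != 1).
have a12 := a_sub_neq0 (isT : (1 : 'I_3) != 2).
have a20 := a_sub_neq0 (isT : (2 : 'I_3) != 0).
have [m1 m2] := tilde_momentum.
have root := sphero_root a01 a12 a20
  (cross_neq0 0) (cross_neq0 1) (cross_neq0 2).
have s1 := tilde_sphero (or_introl (conj erefl erefl)).
have s2 := tilde_sphero (or_intror (conj erefl erefl)).
have [n10 n11 n12] :=
  sphero_neq (cross_neq0 0) (cross_neq0 1) (cross_neq0 2) s1.
have [n20 n21 n22] :=
  sphero_neq (cross_neq0 0) (cross_neq0 1) (cross_neq0 2) s2.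
rewrite /lambda /=.
have [->|->] : k = 0 \/ k = 1.
  by case: k => [[|[|//]] i2]; [left|right]; exact: val_inj.
- by apply: lambda_expr m1 _ _ _ (root _ _ _ s1).
- by apply: lambda_expr m2 _ _ _ (root _ _ _ s2).
Qed.

(** The sum comes from [cross_sqr]; the product is the Gram determinant of gamma and M for the form
    A, by Cauchy-Binet. *)
Lemma tilde_vieta :
  N * (u1 + u2) = al z * N + J z /\ N * (u1 * u2) = al z * J z - tau z ^+ 2.
Proof.
have a01 := a_sub_neq0 (isT : (0 : 'I_3) != 1).
have a12 := a_sub_neq0 (isT : (1 : 'I_3) != 2).
have a20 := a_sub_neq0 (isT : (2 : 'I_3) != 0).
have s1 := tilde_sphero (or_introl (conj erefl erefl)).
rewrite -(sphero_sum a01 a12 a20 s1) -(sphero_prod a01 a12 a20 s1); split.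
  (* The added term, N times the trace of A times 1 - (gamma, gamma), makes this an identity in free
     entries; it vanishes on the level set. *)
  transitivity (al z * N + J z + N * (a 0 + a 1 + a 2) * (1 - dot gam gam)).
    rewrite !cross_sqr /inertia_M /inertia_gamma /= !dotE !AmxE.
    by move: (a 0) (a 1) (a 2) => *; entries; ring.
  by rewrite gam1 subrr mulr0 addr0.
rewrite !mxE !I3_add /inertia_M /inertia_gamma /inertia_mixed /= !dotE !AmxE.
by move: (a 0) (a 1) (a 2) => *; entries; ring.
Qed.

Lemma Ht_lambda :
  Ht d I z = 2^-1 * (lambda d I 0 (ut, pt) + lambda d I 1 (ut, pt)).
Proof.
have [sE qE] := tilde_vieta; have D_gt0 := subr_dal_gt0 d_ge0 I_gt0 gam1.
rewrite !tilde_lambda HtE /= gamM mul0r addr0 g_sqE //.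
(* Vieta's relations eliminate tau^2 and then J, leaving a rational identity in alpha, N and the two
   roots. *)
have -> : tau z ^+ 2 = al z * J z - N * (u1 * u2) by rewrite qE; ring.
have -> : J z = N * (u1 + u2) - al z * N by rewrite sE; ring.
have : 1 - d * al z != 0 by rewrite gt_eqF.
rewrite -[dot gam (A *m gam)]/(al z).
move: (al z) N u1 u2 => x n v1 v2 x0.
by field.
Qed.

Lemma Kt_lambda :
  Kt d I z = - 4 * (lambda d I 0 (ut, pt) * lambda d I 1 (ut, pt)).
Proof.
have [sE qE] := tilde_vieta; have D_gt0 := subr_dal_gt0 d_ge0 I_gt0 gam1.
rewrite !tilde_lambda KtE /= gamM mul0r addr0 g_sqE //.
have -> : tau z ^+ 2 = al z * J z - N * (u1 * u2) by rewrite qE; ring.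
have -> : J z = N * (u1 + u2) - al z * N by rewrite sE; ring.
have : 1 - d * al z != 0 by rewrite gt_eqF.
rewrite -[dot gam (A *m gam)]/(al z).
move: (al z) N u1 u2 => x n v1 v2 x0.
by field.
Qed.

End TildeCoordinates.

(** * Symmetric functions of the lambda_k commute for the second bracket *)

Section SecondBracket.
Variables (R : realType) (d : R) (I : 'I_3 -> R).
Local Notation coord := ('cV[R]_2 * 'cV[R]_2)%type.
Local Notation lam := (lambda d I).

Lemma is_derive_invariant (V : normedModType R) (f : V -> R) x v :
  (forall h : R, f (h *: v + x) = f x) -> is_derive x v f 0.
Proof.
move=> fE.
have cf : (fun h => h^-1 *: ((f \o shift x) (h *: v) - f x)) @ 0^' --> (0 : R).
  by apply: cvg_near_cst; near=> h; rewrite /= fE subrr scaler0.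
by apply: DeriveDef; [apply/cvg_ex; exists 0 | exact: cvg_lim].
Unshelve. all: by end_near. Qed.

Lemma derivable_lambda k (x v : coord) : derivable (lam k) x v.
Proof.
have [du _] := is_derive_fst_entry x v k.
have [dp _] := is_derive_snd_entry x v k.
have dB (c : R) : derivable (fun y : coord => c - y.1 k 0) x v.
  exact: derivableB (derivable_cst c x v) du.
have d4 := derivableM (derivable_cst (4 : R) x v)
  (derivableB (derivableM (derivable_cst (d : R) x v) du)
    (derivable_cst (1 : R) x v)).
exact: derivableM (derivableM (derivableM (derivableM d4 (dB (a d I 0)))
  (dB (a d I 1))) (dB (a d I 2))) (derivableM dp dp).
Qed.

Lemma lambda_invariant k (x v : coord) : v.1 k 0 = 0 -> v.2 k 0 = 0 ->
  'D_v (lam k) x = 0.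
Proof.
move=> v1 v2; suff : is_derive x v (lam k) 0 by case.
apply: is_derive_invariant => h.
by rewrite /lambda /= !mxE v1 v2 mulr0 !add0r.
Qed.

(** In the k-th summand only [lam k] varies, so both partial gradients are multiples of that of
    [lam k] and their 2x2 determinant vanishes. *)
Lemma bracket'_symmetric (b c : R) (phi : 'cV[R]_3 * 'cV[R]_3 -> coord)
    psi f h z :
  (\forall y \near phi z, f (psi y) = b * (lam 0 y + lam 1 y)) ->
  (\forall y \near phi z, h (psi y) = c * (lam 0 y * lam 1 y)) ->
  bracket' d I phi psi f h z = 0.
Proof.
set x := phi z => fE hE.
have Df v : 'D_v (f \o psi) x = b * ('D_v (lam 0) x + 'D_v (lam 1) x).
  have -> : 'D_v (f \o psi) x = 'D_v (b \*: (lam 0 + lam 1)) x.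
    exact: near_eq_derive.
  have l0 : derivable (lam 0) x v by exact: derivable_lambda.
  have l1 : derivable (lam 1) x v by exact: derivable_lambda.
  by rewrite (deriveZ _ (derivableD l0 l1)) (deriveD l0 l1).
have Dh v : 'D_v (h \o psi) x =
    c * (lam 0 x * 'D_v (lam 1) x + lam 1 x * 'D_v (lam 0) x).
  have -> : 'D_v (h \o psi) x = 'D_v (c \*: (lam 0 * lam 1)) x.
    exact: near_eq_derive.
  have l0 : derivable (lam 0) x v by exact: derivable_lambda.
  have l1 : derivable (lam 1) x v by exact: derivable_lambda.
  by rewrite (deriveZ _ (derivableM l0 l1)) (deriveM l0 l1).
have u01 : 'D_(delta_mx 1 0, 0) (lam 0) x = 0.
  by apply: lambda_invariant; rewrite /= mxE.
have p01 : 'D_(0, delta_mx 1 0) (lam 0) x = 0.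
  by apply: lambda_invariant; rewrite /= mxE.
have u10 : 'D_(delta_mx 0 0, 0) (lam 1) x = 0.
  by apply: lambda_invariant; rewrite /= mxE.
have p10 : 'D_(0, delta_mx 0 0) (lam 1) x = 0.
  by apply: lambda_invariant; rewrite /= mxE.
rewrite /bracket' big_ord_recl big_ord1.
have -> : lift ord0 ord0 = 1 :> 'I_2 by exact: val_inj.
rewrite /du /dp -/x !Df !Dh u01 p01 u10 p10.
move: (lam 0 x) (lam 1 x) => l0 l1.
move: ('D_ _ _ _) ('D_ _ _ _) ('D_ _ _ _) ('D_ _ _ _) => x1 x2 x3 x4.
ring.
Qed.

End SecondBracket.

Unset Implicit Arguments.

Theorem mainTheorem3 (R : realType) (d : R) (I : 'I_3 -> R)
    (d_ge0 : 0 <= d) (I_gt0 : forall i, 0 < I i) (I_inj : injective I) :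
  (forall z, level z -> bracket d I (Ht d I) (Kt d I) z = 0) /\
  (forall W phi psi gamt, tilde_coordinates d I W phi psi gamt ->
     forall z, W z -> bracket' d I phi psi (Ht d I) (Kt d I) z = 0).
Proof.
split=> [z [gam1 gamM]|W phi psi gamt [loc _ rel] z Wz].
  exact: bracket_Ht_Kt.
have [[V _ WE] [oW psiK _ _ _]] := loc.
(* The expressions through lambda are available only at points of [W]; openness of its image under
   [phi] makes them hold on a neighbourhood in coordinates, where they can be differentiated. *)
have near_phi : \forall y \near phi z, (phi @` W) y.
  by apply: open_nbhs_nbhs; split => //; exists z.
have HK y : W y ->
    Ht d I y = 2^-1 * (lambda d I 0 (phi y) + lambda d I 1 (phi y)) /\
    Kt d I y = - 4 * (lambda d I 0 (phi y) * lambda d I 1 (phi y)).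
  case: y => gam M Wy; have := rel _ _ Wy.
  case: (phi (gam, M)) => ut pt [M0 _ gtr utr ptr].
  have [gam1 gamM] : level (gam, M) by move: Wy; rewrite WE => -[].
  by split; [exact: (Ht_lambda d_ge0 I_gt0 I_inj gam1 gamM M0 gtr utr ptr)
            |exact: (Kt_lambda d_ge0 I_gt0 I_inj gam1 gamM M0 gtr utr ptr)].
apply: (@bracket'_symmetric _ _ _ (2^-1) (- 4)).
all: apply: filterS near_phi => _ [y Wy <-].
all: by rewrite psiK //; case: (HK y Wy).
Qed.
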